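(* There is an absolute constant $c>0$ such that, for all sufficiently large integers $k$, $$w(3,k)\ge k^{c\log k}.$$
   Context: For a positive integer $n$, $[n]=\{1,\ldots,n\}$. For an integer $k\ge 3$, a $k$-AP is a nontrivial arithmetic progression of length $k$, i.e. a set $\{a,a+d,\ldots,a+(k-1)d\}$ of integers with $d\ge 1$. For an integer $k\ge 3$, $w(3,k)$ denotes the least positive integer $n$ such that every coloring of $[n]$ with the two colors red and blue contains either a 3-AP all of whose elements are blue or a $k$-AP all of whose elements are red (this number is finite by van der Waerden's theorem). $\log$ is the natural logarithm. *)

(* Defs.v *)
From mathcomp Require Import all_boot all_order all_algebra.
From mathcomp Require Import zify.
From mathcomp Require Import all_classical all_reals all_analysis.

Set Implicit Arguments.
Unset Strict Implicit.
Unset Printing Implicit Defensive.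

Inductive color := Red | Blue.

(* [{a, a + d, ..., a + (k - 1) d}] is a [k]-AP contained in [{1, ..., n}] all
   of whose elements have color [x]. *)
Definition has_mono_AP (c : nat -> color) (n : nat) (x : color) (k : nat) : Prop :=
  exists a d : nat, (1 <= d)%N /\
    forall i : nat, (i < k)%N ->
      (1 <= a + i * d <= n)%N /\ c (a + i * d)%N = x.

(* Colorings of [{1, ..., n}] are represented by functions on all of [nat];
   [has_mono_AP] only inspects their values on [{1, ..., n}]. *)
Definition vdw_forces (l k n : nat) : Prop :=
  forall c : nat -> color, has_mono_AP c n Blue l \/ has_mono_AP c n Red k.

Lemma vdw_multicolor (k : nat) (T : finType) : exists N : nat,
  forall f : nat -> T, exists a d : nat,
    [/\ (a <= N)%N, (0 < d <= N)%N &
        forall i : nat, (i <= k)%N -> f (a + i * d)%N = f a].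
Proof.
elim: k T => [|k IHk] T.
  by exists 1%N => f; exists 0%N, 1%N; split=> // i; rewrite leqn0 => /eqP ->.
(* Color focusing: [ds] lists the differences of [r] monochromatic APs of
   pairwise distinct colors whose extensions to the left meet at [x]. *)
have focus (r : nat) : exists N : nat, forall f : nat -> T,
    (exists a d : nat, [/\ (a <= N)%N, (0 < d <= N)%N &
        forall i : nat, (i <= k.+1)%N -> f (a + i * d)%N = f a]) \/
    (exists (x : nat) (ds : seq nat),
      [/\ (x <= N)%N, size ds = r, uniq [seq f (x + d)%N | d <- ds] &
        forall d, d \in ds -> (0 < d <= N)%N /\
          forall i, (1 <= i <= k.+1)%N -> f (x + i * d)%N = f (x + d)%N]).
  elim: r => [|r [N HN]]; first by exists 0%N => f; right; exists 0%N, [::].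
  pose M := (N + k.+1 * N).+1.
  have [N' HN'] := IHk {ffun 'I_M -> T}.
  exists (N' + N' + N)%N => f.
  have [b [e [bN /andP[e0 eN] He]]] :=
    HN' (fun n => [ffun j : 'I_M => f (n + N' + j)%N]).
  pose B := (b + N' - e)%N.
  have blk i j : (1 <= i <= k.+1)%N -> (j < M)%N ->
      f (B + i * e + j)%N = f (B + e + j)%N.
    case: i => // i /= ik jM.
    have /ffunP/(_ (Ordinal jM)) := He i ik.
    rewrite !ffunE /= => H.
    have -> : (B + i.+1 * e + j = b + i * e + N' + j)%N by rewrite /B mulSn; lia.
    by rewrite H; congr f; rewrite /B; lia.
  have posM x d i : (x <= N)%N -> (d <= N)%N -> (i <= k.+1)%N ->
      (x + i * d < M)%N.
    by move=> xN dN ik; rewrite /M ltnS leq_add // leq_mul.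
  have [[a [d [aN /andP[d0 dN] Hd]]]|[x [ds [xN sz un Hds]]]] :=
      HN (fun j => f (B + e + j)%N).
    left; exists (B + e + a)%N, d; split; [rewrite /B; lia | lia |].
    by move=> i ik; rewrite -addnA Hd.
  have [/mapP[d dds Ed]|nin] :=
      boolP (f (B + e + x)%N \in [seq f (B + e + (x + d))%N | d <- ds]).
    have [/andP[d0 dN] Hd] := Hds _ dds.
    left; exists (B + e + x)%N, d; split; [rewrite /B; lia | lia |].
    case=> [|i] ik; first by rewrite mul0n addn0.
    by rewrite -addnA Hd // Ed.
  right; exists (B + x)%N, (e :: [seq (d + e)%N | d <- ds]).
  have colE d : (B + x + (d + e) = B + e + (x + d))%N by lia.
  split; first by rewrite /B; lia.
  - by rewrite /= size_map sz.
  - rewrite /= -map_comp.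
    have -> : [seq ((fun d => f (B + x + d)%N) \o addn^~ e) i | i <- ds] =
              [seq f (B + e + (x + d))%N | d <- ds].
      by apply: eq_map => d /=; rewrite colE.
    by rewrite addnAC nin un.
  - move=> d'; rewrite inE => /orP[/eqP -> | /mapP[d dds ->]].
      split; first by lia.
      move=> i ik; have := @blk i x ik; rewrite addnAC => ->; last by rewrite /M; lia.
      by rewrite addnAC.
    have [/andP[d0 dN] Hd] := Hds _ dds.
    split; first by lia.
    move=> i /[dup] ik /andP[_ ik'].
    have -> : (B + x + i * (d + e) = B + i * e + (x + i * d))%N by lia.
    by rewrite blk ?posM // Hd // colE.
have [N HN] := focus #|T|.+1.
exists N => f; have [//|[x [ds [_ sz un _]]]] := HN f.
have := max_card (mem [seq f (x + d)%N | d <- ds]).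
by rewrite (card_uniqP un) size_map sz ltnn.
Qed.

Lemma vdw_finite (l k : nat) :
  exists n : nat, (0 < n)%N && `[< vdw_forces l k n >].
Proof.
have [N HN] := vdw_multicolor (maxn l k) bool.
pose n := (N + maxn l k * N).+1.
exists n; rewrite /=; apply/asboolP => c.
have [a [d [aN /andP[d0 dN] H]]] := HN (fun m => if c m.+1 is Blue then true else false).
have AP m x : (m <= maxn l k)%N -> c a.+1 = x -> has_mono_AP c n x m.
  move=> mk cx; exists a.+1, d; split=> // i im.
  have ik : (i <= maxn l k)%N by exact: leq_trans (ltnW im) mk.
  rewrite addSn /= /n; split; first by rewrite ltnS leq_add // leq_mul.
  by rewrite -cx; move: (H i ik); case: (c _.+1); case: (c _.+1).
by case E: (c a.+1); [right | left]; apply: AP => //; rewrite ?leq_maxl ?leq_maxr.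
Qed.

Definition w (l k : nat) : nat := ex_minn (vdw_finite l k).

(* Main.v *)
Require Import Defs.
From mathcomp Require Import all_classical all_reals all_analysis.
From mathcomp Require Import all_boot all_order all_algebra.
From mathcomp Require Import zify ring.

Set Implicit Arguments.
Unset Strict Implicit.
Unset Printing Implicit Defensive.

Import Order.TTheory GRing.Theory Num.Theory.
Local Open Scope nat_scope.

(** A random linear map [n |-> theta * n] into the torus [(Z/p)^D], with [p] a
huge prime, turns progressions of integers into progressions of the torus.
Fix a small cell, a cube whose side [L] is a small constant proportion of [p].
A piece of the blue set consists of the [n] that land in a translate [c] of the
cell and at which a paraboloid hits a short window: with [e] the vector of
residues of [theta * n - c],

    G |e|^2 + lambda n + mu  mod p'  lies in  [0, Delta).

On a 3-AP inside one cell the linear part has second difference zero, while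
[G |e|^2] has second difference [2 G |v|^2], where [v] is the step; no wrap-around
is possible modulo [p'], so three values in the window force [G |v|^2 < Delta],
which fails as soon as some coordinate of [theta * d] is at least [m] away from 0
and [Delta <= G m^2]. This is the parallelogram law behind Behrend's construction.
A 3-AP across several pieces is excluded by choosing the centres so that
[c1 + c3 - 2 c2] is near 0 only if the three pieces coincide.

The linear form [lambda n + mu] also makes the events that [n] falls into the window
pairwise independent for distinct [n], so a progression with several points in
a cell, but not more than about the inverse density of the window, hits the
piece with probability comparable to its number of points there
([window_hit_many], [many_hits]). It remains to keep a progression from
clumping: no cell should contain more than [T] of its [k] points, for almost all
translates. In one coordinate, the points [i * y + z] with [y], [z]
random are again pairwise independent, so by Chebyshev's inequality a set of
more than [T] indices shrinks by the factor [K] except with probability [1 / E].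
For clumping to occur, a positive proportion of the [D] coordinates must fail, and
this has probability [E ^ (- Omega(D))] ([trace_rarely_large]). With [D] of order
[log k] and [E] exponential in [D], this probability is [exp (- Omega (log^2 k))],
which leaves room for a union bound over [N = exp (Omega (log^2 k))] common differences
([exists_generic_frequencies]).

Finally the pieces are chosen one after the other, each killing a fixed
proportion [1 / B] of the progressions not yet met and avoiding conflicts with the
previous centres ([greedy_cover], [few_conflicts]). As [1 / B] exceeds the
cube root of the relative volume of a cell by an exponential factor, the cells of all
the pieces together are sparse enough for conflicts to be avoidable. In [coloring_of_parameters] all
quantities are powers of 2: [D = 6 t], [k = 2 ^ (255 t)] and [N = 2 ^ (t ^ 2)]. *)

(** * Pairwise independence of random affine forms *)

Section PairwiseIndependence.
Variables (F : finFieldType) (A : finType) (S : {set F}) (J : {set A}).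
Variables (alpha beta : A -> F).
Hypothesis alpha_inj : {in J &, injective alpha}.

Definition in_window (b : F * F) (i : A) : bool :=
  (alpha i * b.1 + b.2 + beta i)%R \in S.

Definition window_count (b : F * F) : nat := \sum_(i in J) in_window b i.

Lemma sum_in_window i : \sum_b in_window b i = #|F| * #|S|.
Proof.
rewrite /in_window -(pair_bigA _ (fun y z => nat_of_bool ((alpha i * y + z + beta i)%R \in S))) /=.
rewrite -sum_nat_const; apply: eq_bigr => y _.
rewrite -sum1_card [RHS]big_mkcond /=.
rewrite [RHS](reindex_inj (h := fun z => (alpha i * y + z + beta i)%R)) //=.
by move=> z z' /addIr /addrI.
Qed.

(** For [i != j] the values at [i] and [j] determine [b] and are arbitrary. *)
Lemma sum_in_window2 i j : i \in J -> j \in J -> i != j ->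
  \sum_b in_window b i * in_window b j = #|S| ^ 2.
Proof.
move=> iJ jJ ij.
have inj : injective (fun b : F * F =>
    ((alpha i * b.1 + b.2 + beta i)%R, (alpha j * b.1 + b.2 + beta j)%R)).
  move=> [y z] [y' z'] /= [/addIr Ei /addIr Ej].
  have nz : (alpha i - alpha j != 0)%R.
    by rewrite subr_eq0; apply: contra ij => /eqP /(alpha_inj iJ jJ) ->.
  have yy' : y = y'.
    apply: (mulfI nz); rewrite !mulrBl.
    have -> : (alpha i * y - alpha j * y = (alpha i * y + z) - (alpha j * y + z))%R by ring.
    by rewrite Ei Ej; ring.
  by move: Ei; rewrite yy' => /addrI ->.
pose g (y z : F) : nat := (y \in S) * (z \in S).
rewrite -[LHS](reindex_inj inj (P := xpredT) (F := fun b : F * F => g b.1 b.2)).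
rewrite -(pair_bigA _ g) /= /g.
under eq_bigr => y _ do rewrite -big_distrr /=.
have cS : \sum_(z : F) (z \in S : nat) = #|S| by rewrite -sum1_card [RHS]big_mkcond.
by rewrite -big_distrl /= cS mulnn.
Qed.

Lemma sum_window_count : \sum_b window_count b = #|J| * (#|F| * #|S|).
Proof.
rewrite exchange_big -sum_nat_const; apply: eq_bigr => i _.
exact: sum_in_window.
Qed.

Lemma sum_window_count_sqr :
  \sum_b window_count b ^ 2 = #|J| * (#|F| * #|S|) + #|J| * #|J|.-1 * #|S| ^ 2.
Proof.
have -> : \sum_b window_count b ^ 2 =
    \sum_(i in J) \sum_(j in J) \sum_b in_window b i * in_window b j.
  under [RHS]eq_bigr => i _ do rewrite exchange_big /=.
  rewrite exchange_big /=; apply: eq_bigr => b _.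
  by rewrite -mulnn big_distrlr.
rewrite -mulnA -mulnDr -sum_nat_const; apply: eq_bigr => i iJ.
rewrite (bigD1 i) //=; congr (_ + _).
  rewrite -(sum_in_window i); apply: eq_bigr => b _.
  by case: in_window.
rewrite (eq_bigr (fun=> #|S| ^ 2)); last first.
  by move=> j /andP[jJ ji]; apply: sum_in_window2; rewrite // eq_sym.
rewrite (cardsD1 i J) iJ /= -sum_nat_const; apply: eq_bigl => j.
by rewrite !inE andbC.
Qed.

(** Chebyshev's inequality: the window count has mean [#|S| * #|J| / #|F|] and a
variance below its mean. *)
Lemma window_count_concentrated :
  #|[set b | 2 * #|S| * #|J| < #|F| * window_count b]| * (#|S| * #|J|) <= #|F| ^ 3.
Proof.
set q := #|F|; set n := #|S| * #|J|; set bad := [set b | _].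
have [->|n_gt0] := posnP n; first by rewrite muln0.
have q_gt0 : 0 < q by apply/card_gt0P; exists 0%R.
have card_bad : \sum_(b : F * F) (b \in bad) * n ^ 2 = #|bad| * n ^ 2.
  by rewrite -big_distrl /= -big_mkcond sum1_card.
have card_const : \sum_(b : F * F) n ^ 2 = q ^ 2 * n ^ 2.
  by rewrite sum_nat_const card_prod -mulnn.
(* Pointwise, deviating from the mean by more than the mean costs [n ^ 2] in
   the square of [q * window_count b - n]. *)
have dev (b : F * F) :
    (b \in bad) * n ^ 2 + 2 * q * n * window_count b
      <= q ^ 2 * window_count b ^ 2 + n ^ 2.
  rewrite inE -mulnA -/n -/q -expnMn.
  have -> : 2 * q * n * window_count b = 2 * (n * (q * window_count b)) by ring.
  move: (q * window_count b) => x; case: ltnP => [big|_].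
    by rewrite mul1n addnC leq_add2r -mulnn mulnA leq_mul2r (ltnW big) orbT.
  by rewrite mul0n add0n [leqRHS]addnC nat_Cauchy.
have := @leq_sum _ (index_enum _) xpredT _ _ (fun b _ => dev b).
rewrite !big_split /= card_bad card_const -!big_distrr /= sum_window_count
  sum_window_count_sqr -/q.
move: n_gt0; rewrite /n; move: (#|J|) (#|bad|) (#|S|) => [|j] X L /= n_gt0 le.
  by rewrite muln0 in n_gt0.
by rewrite -(leq_pmul2r n_gt0); nia.
Qed.

(** The second moment bounds the chance of a hit from below when the mean is at
most 1. The inequality [3 X <= 2 [X > 0] + X ^ 2] on naturals packages inclusion-exclusion
truncated at pairs. *)
Lemma window_hit_many : #|J| * #|S| <= #|F| ->
  #|J| * (#|F| * #|S|) <= 2 * #|[set b | 0 < window_count b]|.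
Proof.
move=> small; set H := [set b | _].
have pt (b : F * F) : 3 * window_count b <= 2 * (b \in H) + window_count b ^ 2.
  rewrite inE; case: (window_count b) => [|[|[|x]]] //=; nia.
have card_H : \sum_(b : F * F) (b \in H) = #|H| by rewrite -big_mkcond sum1_card.
have := @leq_sum _ (index_enum _) xpredT _ _ (fun b _ => pt b).
rewrite -big_distrr big_split -big_distrr /= card_H sum_window_count.
rewrite sum_window_count_sqr => le.
have le2 : #|J| * #|J|.-1 * #|S| ^ 2 <= #|J| * (#|F| * #|S|).
  rewrite -mulnA leq_mul2l -mulnn mulnA leq_mul ?orbT //.
  by apply: leq_trans small; rewrite leq_mul2r leq_pred orbT.
move: le le2; move: #|H| (_ * _ ^ 2) (#|J| * _) => h Y X.
clear; lia.
Qed.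
End PairwiseIndependence.

(** * Iterated thinning by random windows *)

Section Thinning.
Variables (F : finFieldType) (A : finType) (S : {set F}) (alpha : A -> F).
Hypothesis alpha_inj : injective alpha.

Definition slice (J : {set A}) (b : F * F) : {set A} :=
  [set i in J | (alpha i * b.1 + b.2)%R \in S].

Lemma card_slice J b : #|slice J b| = window_count S J alpha (fun=> 0%R) b.
Proof.
rewrite -sum1dep_card [LHS]big_mkcondr /=; apply: eq_bigr => i _.
by rewrite /in_window addr0; case: (_ \in S).
Qed.

Definition trace (J : {set A}) (v : seq (F * F)) : {set A} :=
  [set i in J | all (fun b => (alpha i * b.1 + b.2)%R \in S) v].

Lemma trace_cons J b v : trace J (b :: v) = trace (slice J b) v.
Proof. by apply/setP => i; rewrite !inE /= andbA. Qed.

Lemma sum_tuple_cons (X : finType) n (f : n.+1.-tuple X -> nat) :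
  \sum_v f v = \sum_x \sum_(v : n.-tuple X) f [tuple of x :: v].
Proof.
rewrite pair_bigA /=.
rewrite (reindex (fun xv : X * n.-tuple X => [tuple of xv.1 :: xv.2])) //=.
exists (fun v => (thead v, [tuple of behead v])) => [[x v] _ | v _] /=.
  by congr (_, _); apply: val_inj.
by rewrite [RHS]tuple_eta; apply: val_inj.
Qed.

Variables (T K E : nat).
Hypothesis window_small : 2 * #|S| * K <= #|F|.
Hypothesis rare : E * #|F| <= #|S| * T.

(** Each coordinate divides the number of surviving indices by [K] as long as more
than [T] survive, up to failures of probability [1 / E]. Starting from
[T * K ^ s] indices, more than [T] can survive [n] coordinates only if at least [n - s]
of them fail; the factor [2 ^ n] pays for the choice of these coordinates. *)
Lemma trace_rarely_large n s (J : {set A}) : #|J| <= T * K ^ s ->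
  #|[set v : n.-tuple (F * F) | T < #|trace J v|]| * E ^ (n - s)
    <= (2 * #|F| ^ 2) ^ n.
Proof.
set q := #|F|.
have q_gt0 : 0 < q by apply/card_gt0P; exists 0%R.
have card_trivial m (P : pred (m.-tuple (F * F))) : #|[set v | P v]| <= (2 * q ^ 2) ^ m.
  apply: (leq_trans (max_card _)); rewrite card_tuple card_prod mulnn.
  by case: m {P} => // m; rewrite leq_exp2r // leq_pmull.
elim: n s J => [|n IHn] s J le_J; first by rewrite sub0n muln1 card_trivial.
have [le_ns|lt_sn] := leqP n.+1 s.
  by move: le_ns; rewrite -subn_eq0 => /eqP ->; rewrite muln1 card_trivial.
have [small_J|big_J] := leqP #|J| T.
  rewrite (_ : [set v | _] = set0) ?cards0 //; apply/setP => v; rewrite !inE.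
  apply/negbTE; rewrite -leqNgt; apply: leq_trans small_J.
  by apply: subset_leq_card; apply/subsetP => i; rewrite inE => /andP[].
case: s lt_sn le_J => [|s] lt_sn le_J.
  by move: le_J; rewrite muln1 leqNgt big_J.
(* A first coordinate that fails costs a factor [E]; one that succeeds lowers
   [s]. Both branches of the induction contribute the same bound. *)
set bad := [set b | 2 * #|S| * #|J| < q * #|slice J b|].
have card_bad : #|bad| * E <= q ^ 2.
  have := @window_count_concentrated F A S J alpha (fun=> 0%R) (in2W alpha_inj).
  rewrite (eq_card (B := bad)) => [|b]; last by rewrite !inE card_slice.
  rewrite -/q => le; rewrite -(leq_pmul2r q_gt0) -expnSr -mulnA.
  apply: leq_trans le; rewrite leq_mul2l; apply/orP; right.
  by apply: leq_trans rare _; rewrite leq_mul2l ltnW ?orbT.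
pose cnt b := #|[set v : n.-tuple (F * F) | T < #|trace (slice J b) v|]|.
have -> : #|[set v : n.+1.-tuple (F * F) | T < #|trace J v|]| = \sum_b cnt b.
  rewrite -sum1dep_card big_mkcond sum_tuple_cons; apply: eq_bigr => b _.
  by rewrite /cnt -sum1dep_card [RHS]big_mkcond; apply: eq_bigr => v _; rewrite trace_cons.
set P := (2 * q ^ 2) ^ n.
have subJ b : #|slice J b| <= #|J|.
  by apply: subset_leq_card; apply/subsetP => i; rewrite inE => /andP[].
have cnt_bad b : cnt b * E ^ (n - s.+1) <= P.
  by apply: IHn; apply: leq_trans (subJ b) le_J.
have cnt_good b : b \notin bad -> cnt b * E ^ (n - s) <= P.
  rewrite inE -leqNgt => le; apply: IHn.
  rewrite -(leq_pmul2l q_gt0); apply: leq_trans le _.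
  apply: (leq_trans (leq_mul (leqnn _) le_J)).
  rewrite (_ : _ * (T * K ^ s.+1) = 2 * #|S| * K * (T * K ^ s)); last by rewrite expnS; ring.
  by rewrite leq_mul2r window_small orbT.
rewrite subSS (bigID (mem bad)) /= mulnDl.
apply: (@leq_trans (q ^ 2 * P + q ^ 2 * P)); last first.
  by rewrite [leqRHS]expnS -mulnA mul2n -addnn leqnn.
apply: leq_add.
  have -> : n - s = (n - s.+1).+1 by rewrite subnSK.
  rewrite expnS mulnCA; apply: leq_trans (_ : E * (#|bad| * P) <= _); last first.
    by rewrite mulnCA mulnA leq_mul2r card_bad orbT.
  rewrite leq_mul2l; apply/orP; right.
  by rewrite big_distrl /= -sum_nat_const leq_sum.
rewrite big_distrl /=; apply: (@leq_trans (\sum_(b | b \notin bad) P)).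
  exact: leq_sum.
rewrite sum_nat_const leq_mul2r; apply/orP; right.
by apply: (leq_trans (max_card _)); rewrite card_prod mulnn.
Qed.
End Thinning.

(** * Frequencies without clumping *)

Lemma card_le_inj (X Y : finType) (f : X -> Y) (P : pred X) (Q : pred Y) :
  injective f -> (forall x, P x -> Q (f x)) ->
  #|[set x | P x]| <= #|[set y | Q y]|.
Proof.
move=> f_inj PQ; rewrite -(card_imset _ f_inj); apply: subset_leq_card.
by apply/subsetP => _ /imsetP[x Px ->]; move: Px; rewrite !inE; apply: PQ.
Qed.

Lemma union_bound (I X : finType) (P : I -> pred X) :
  \sum_i #|[set x | P i x]| < #|X| -> exists x, forall i, ~~ P i x.
Proof.
move=> lt; have [/existsP[x /forallP]|] := boolP [exists x, [forall i, ~~ P i x]].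
  by exists x.
rewrite negb_exists => /forallP all_bad; move: lt; rewrite ltnNge => /negP[].
have -> : \sum_i #|[set x | P i x]| = \sum_x \sum_i P i x.
  rewrite exchange_big /=; apply: eq_bigr => i _.
  by rewrite -sum1dep_card big_mkcond.
rewrite -sum1_card; apply: leq_sum => x _.
have := all_bad x; rewrite negb_forall => /existsP[i]; rewrite negbK => Pix.
by rewrite (bigD1 i) //= Pix.
Qed.

Section Frequencies.
Variables (F : finFieldType) (A : finType) (S : {set F}) (alpha : A -> F).
Hypothesis alpha_inj : injective alpha.
Variables (D : nat).
Local Notation vec := {ffun 'I_D -> F}.

Definition visits (y z : vec) : {set A} :=
  [set i | [forall l, (alpha i * y l + z l)%R \in S]].

Lemma card_vec_in (P : {set F}) : #|[set c : vec | [forall l, c l \in P]]| = #|P| ^ D.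
Proof.
rewrite -[X in _ ^ X]card_ord -card_ffun_on; apply: eq_card => c.
by rewrite inE; apply/forallP/ffun_onP.
Qed.

Variables (T K E Q s : nat).
Hypothesis window_small : 2 * #|S| * K <= #|F|.
Hypothesis rare : E * #|F| <= #|S| * T.
Hypothesis card_A : #|A| <= T * K ^ s.

(** [1 / Q] is the tolerated proportion of translates of the cell that contain more than
[T] points of a progression with step [y]. *)
Definition clumped (y : vec) : bool :=
  #|F| ^ D < #|[set z | T < #|visits y z|]| * Q.

Lemma clumped_rare :
  #|[set y | clumped y]| * E ^ (D - s) <= Q * 2 ^ D * #|F| ^ D.
Proof.
set q := #|F|; set U := #|_|.
have q_gt0 : 0 < q by apply/card_gt0P; exists 0%R.
pose V := #|[set yz : vec * vec | T < #|visits yz.1 yz.2|]|.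
have le_V : V * E ^ (D - s) <= (2 * q ^ 2) ^ D.
  have := @trace_rarely_large F A S alpha alpha_inj T K E window_small rare D s setT.
  rewrite cardsT => /(_ card_A); apply: leq_trans.
  rewrite leq_mul2r; apply/orP; right.
  apply: (card_le_inj (f := fun yz : vec * vec => [tuple (yz.1 l, yz.2 l) | l < D])).
    move=> [y z] [y' z'] /= eq_t; have ext l : (y l, z l) = (y' l, z' l).
      by have := congr1 (fun t => tnth t l) eq_t; rewrite !tnth_mktuple.
    by congr (_, _); apply/ffunP => l; have [] := ext l.
  move=> [y z] /=; rewrite (_ : visits y z = trace S alpha setT [tuple (y l, z l) | l < D]) //.
  apply/setP => i; rewrite !inE andTb.
  apply/forallP/all_tnthP => H l; first by rewrite tnth_mktuple; apply: H.
  by have := H l; rewrite tnth_mktuple.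
have UV : U * q ^ D <= V * Q.
  rewrite /V -sum1dep_card big_mkcond.
  rewrite -(pair_bigA _ (fun y z => if T < #|visits y z| then 1 else 0)) /=.
  rewrite -sum_nat_const big_distrl big_mkcond /=; apply: leq_sum => y _.
  rewrite inE; case: ifP => // /ltnW; rewrite -sum1dep_card -big_mkcond //.
rewrite -(leq_pmul2r (_ : 0 < q ^ D)) ?expn_gt0 ?q_gt0 //.
apply: (@leq_trans (V * Q * E ^ (D - s))).
  by rewrite mulnAC leq_mul2r UV orbT.
rewrite mulnAC; apply: leq_trans (leq_mul le_V (leqnn Q)) _.
by rewrite expnMn mulnC -!mulnA -expnD addnn -mul2n expnM.
Qed.

Variables (I : finType) (delta : I -> F) (Z : {set F}).
Hypothesis delta_neq0 : forall d, delta d != 0%R.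

(** Multiplication by [delta d] permutes the vectors, so for each common difference a
random [theta] behaves like a uniformly random step, and a union bound
applies. *)
Lemma exists_generic_frequencies :
  2 * #|I| * #|Z| ^ D < #|F| ^ D -> 2 * #|I| * Q * 2 ^ D < E ^ (D - s) ->
  exists theta : vec, forall d,
    [exists l, (delta d * theta l)%R \notin Z] /\
    #|[set z | T < #|visits [ffun l => delta d * theta l]%R z|]| * Q <= #|F| ^ D.
Proof.
move=> few_Z few_clumped; set q := #|F|.
have scale_inj d : injective (fun y : vec => [ffun l => delta d * y l]%R).
  move=> y y' /ffunP H; apply/ffunP => l; have := H l.
  by rewrite !ffunE => /(mulfI (delta_neq0 d)).
pose bad d (y : vec) := let y' := [ffun l => delta d * y l]%R in
  [forall l, y' l \in Z] || clumped y'.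
have [|theta Htheta] := union_bound (P := bad).
  pose U := #|[set y | clumped y]|.
  have card_bad d : #|[set y | bad d y]| <= #|Z| ^ D + U.
    apply: (@leq_trans #|[set y : vec | [forall l, y l \in Z] || clumped y]|).
      exact: (card_le_inj (scale_inj d)).
    rewrite -card_vec_in (_ : [set y | _] = [set c : vec | [forall l, c l \in Z]] :|: [set y | clumped y]).
      exact: leq_card_setU.
    by apply/setP => y; rewrite !inE.
  apply: (@leq_ltn_trans (\sum_(d : I) (#|Z| ^ D + U))).
    by apply: leq_sum => d _; apply: card_bad.
  rewrite sum_nat_const card_ffun card_ord mulnDr -/q.
  have E_gt0 : 0 < E ^ (D - s) by apply: leq_ltn_trans few_clumped.
  have few_U : 2 * #|I| * U <= q ^ D.
    rewrite -(leq_pmul2r E_gt0) -mulnA.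
    apply: leq_trans (leq_mul (leqnn _) clumped_rare) _.
    by rewrite mulnA mulnC leq_mul2l mulnA ltnW ?orbT.
  by move: few_Z few_U; rewrite -!mulnA; move: (#|I| * U) (#|I| * _) (q ^ _) => x y z; clear; lia.
exists theta => d; have := Htheta d; rewrite /bad negb_or => /andP[nZ nclumped].
split; last by rewrite leqNgt.
by move: nZ; rewrite negb_forall => /existsP[l]; rewrite ffunE => ?; apply/existsP; exists l.
Qed.
End Frequencies.

(** * A random piece meets a given progression *)

Section Hitting.
Variables (F F' : finFieldType) (A : finType) (S : {set F}) (W : {set F'}).
Variables (alpha : A -> F) (gamma : A -> F') (D T Q : nat).
Local Notation vec := {ffun 'I_D -> F}.
Variables (x y : vec) (beta : vec -> A -> F').
Hypothesis gamma_inj : injective gamma.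
Hypothesis seldom_crowded : #|[set z | T < #|visits S alpha y z|]| * Q <= #|F| ^ D.
Hypothesis Q_large : 2 * #|F| ^ D <= Q * #|S| ^ D.
Hypothesis W_small : T * #|W| <= #|F'|.

(** [x] and [y] are the first term and the step of the progression in the torus; [beta] stands
for the quadratic part, which depends on the centre but not on the affine
form. *)
Definition hits (omega : vec * (F' * F')) : bool :=
  [exists i, (i \in visits S alpha y (x - omega.1)%R)
             && in_window W gamma (beta omega.1) omega.2 i].

(** Over all centres the cell contains [#|A| * #|S| ^ D] points of the progression in total,
and the rare crowded centres account for at most half of them. At each other centre
the affine form finds a point in the window with probability proportional to the
number of points in the cell. *)
Lemma many_hits :
  #|A| * #|S| ^ D * (#|F'| * #|W|) <= 4 * #|[set omega | hits omega]|.
Proof.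
have q_gt0 : 0 < #|F| by apply/card_gt0P; exists 0%R.
pose J (c : vec) := visits S alpha y (x - c)%R.
pose h c := #|[set b | hits (c, b)]|.
have -> : #|[set omega | hits omega]| = \sum_c h c.
  rewrite -sum1dep_card big_mkcond.
  rewrite -(pair_bigA _ (fun c b => if hits (c, b) then 1 else 0)) /=.
  by apply: eq_bigr => c _; rewrite /h -sum1dep_card [RHS]big_mkcond.
have sumJ : #|A| * #|S| ^ D <= \sum_c #|J c|.
  rewrite (eq_bigr (fun c => \sum_i (i \in J c))); last first.
    by move=> c _; rewrite -sum1_card big_mkcond.
  rewrite exchange_big -sum_nat_const; apply: leq_sum => i _.
  rewrite -big_mkcond sum1dep_card -card_vec_in.
  apply: (card_le_inj (f := fun c : vec => [ffun l => alpha i * y l + x l - c l]%R)).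
    move=> c c' /ffunP H; apply/ffunP => l; have := H l.
    by rewrite !ffunE => /addrI /oppr_inj.
  move=> c /forallP H; rewrite inE; apply/forallP => l; rewrite !ffunE.
  have cancel (a b u : F) : (a + (b - (a + b - u)) = u)%R by ring.
  by rewrite cancel.
pose crowded := [set c | T < #|J c|].
have card_crowded : 2 * #|crowded| <= #|S| ^ D.
  have le : #|crowded| * Q <= #|F| ^ D.
    apply: leq_trans seldom_crowded; rewrite leq_mul2r; apply/orP; right.
    by apply: (card_le_inj (f := fun c : vec => (x - c)%R)) => [c c' /addrI /oppr_inj|].
  have qD_gt0 : 0 < #|F| ^ D by rewrite expn_gt0 q_gt0.
  rewrite -(leq_pmul2r qD_gt0) mulnAC.
  apply: leq_trans (leq_mul Q_large (leqnn _)) _.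
  by rewrite mulnAC mulnC leq_mul2l mulnC le orbT.
have sum_crowded : 2 * \sum_(c in crowded) #|J c| <= #|A| * #|S| ^ D.
  apply: (@leq_trans (#|A| * (2 * #|crowded|))); last by rewrite leq_mul2l card_crowded orbT.
  rewrite mulnCA leq_mul2l /= mulnC -sum_nat_const; apply: leq_sum => c _.
  exact: max_card.
have hit_one c : c \notin crowded -> #|J c| * (#|F'| * #|W|) <= 2 * h c.
  rewrite inE -leqNgt => le_T.
  apply: leq_trans (window_hit_many (S := W) (J := J c) (alpha := gamma) (beta c) (in2W gamma_inj) _) _.
    by apply: leq_trans W_small; rewrite leq_mul2r le_T orbT.
  rewrite leq_mul2l /=; apply: subset_leq_card; apply/subsetP => b; rewrite !inE.
  rewrite lt0n sum_nat_eq0 negb_forall => /existsP[i].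
  rewrite negb_imply eqb0 negbK => /andP[iJ hit].
  by apply/existsP; exists i; rewrite iJ.
have sum_calm : #|A| * #|S| ^ D <= 2 * \sum_(c | c \notin crowded) #|J c|.
  move: sumJ; rewrite (bigID (mem crowded)) /=; move: sum_crowded.
  set a := \sum_(c in crowded) _; set b := \sum_(c | _) _; set N := #|A| * _.
  by move: a b N => a b N; clear; lia.
apply: leq_trans (leq_mul sum_calm (leqnn _)) _.
rewrite -mulnA (_ : 4 = 2 * 2) // -mulnA leq_mul2l /= big_distrl big_distrr /=.
apply: (@leq_trans (\sum_(c | c \notin crowded) 2 * h c)); first exact: leq_sum.
by rewrite [leqRHS](bigID (mem crowded)) /= leq_addl.
Qed.
End Hitting.

(** * Greedy choice of the pieces *)

Section GreedyCover.
Variables (O R : finType) (hit : R -> pred O) (good : pred (seq O)).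
Variables (B H M : nat).
Hypothesis O_gt0 : 0 < #|O|.
Hypothesis good_nil : good [::].
Hypothesis few_bad : forall s, good s -> size s < M ->
  8 * #|[set o | ~~ good (o :: s)]| <= H.
Hypothesis many_hit : forall r, H <= 4 * #|[set o | hit r o]|.
Hypothesis B_large : 8 * #|O| <= B * H.

Definition missed (s : seq O) : {set R} := [set r | ~~ has (hit r) s].

(** On average over the choices that keep the selection good, a new element hits
at least [1 / B] of what is missed: bad choices are at most half as many as
the hits of any single requirement. *)
Lemma greedy_step s : good s -> size s < M -> 0 < #|missed s| ->
  exists2 o, good (o :: s) & #|missed (o :: s)| * B <= #|missed s| * B.-1.
Proof.
move=> good_s sz missed_gt0; set U := missed s.
pose gain o := #|[set r in U | hit r o]|.
have [/existsP[ o /andP[good_o gain_o]]|] :=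
    boolP [exists o, good (o :: s) && (#|U| <= B * gain o)].
  exists o => //; suff Usplit : #|U| = #|missed (o :: s)| + gain o.
    by move: gain_o; rewrite Usplit; case: B => [|b] /=; nia.
  rewrite addnC -(cardsID [set r | hit r o] U); congr (_ + _).
    by apply: eq_card => r; rewrite !inE.
  by apply: eq_card => r; rewrite !inE /= negb_or.
rewrite negb_exists => /forallP no_o; exfalso.
pose G := [set o | good (o :: s)].
have GC : [set o | ~~ good (o :: s)] = ~: G by apply/setP => o; rewrite !inE.
have total : #|U| * H <= 8 * \sum_(o in G) gain o.
  rewrite (eq_bigr (fun o => \sum_(r in U) hit r o)); last first.
    by move=> o _; rewrite /gain -sum1dep_card [LHS]big_mkcondr.
  rewrite exchange_big big_distrr -sum_nat_const /=; apply: leq_sum => r _.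
  rewrite -big_mkcondr sum1dep_card.
  have := few_bad good_s sz; have := many_hit r; rewrite GC.
  have : #|[set o | hit r o]| <= #|[set o | (o \in G) && hit r o]| + #|~: G|.
    rewrite -(cardsID G) leq_add //; first by apply: subset_leq_card; apply/subsetP => o; rewrite !inE andbC.
    by apply: subset_leq_card; apply/subsetP => o; rewrite !inE => /andP[].
  by move: (#|[set o | _]|) (#|[set o | _]|) (#|~: G|) => a b c; clear; lia.
have lt : B * \sum_(o in G) gain o < #|O| * #|U|.
  apply: (@leq_ltn_trans (#|O| * #|U|.-1)); last by rewrite ltn_pmul2l // prednK.
  rewrite big_distrr /=; apply: (@leq_trans (\sum_(o in G) #|U|.-1)).
    apply: leq_sum => o; rewrite inE => good_o.
    by have := no_o o; rewrite good_o -ltnNge => lt; rewrite -ltnS prednK.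
  by rewrite sum_nat_const leq_mul2r max_card orbT.
have : #|U| * (8 * #|O|) <= 8 * (B * \sum_(o in G) gain o).
  apply: leq_trans (leq_mul (leqnn _) B_large) _.
  by rewrite mulnCA [leqRHS]mulnCA leq_mul2l total orbT.
by rewrite mulnCA leq_pmul2l // mulnC leqNgt lt.
Qed.

Lemma greedy_iter n : n <= M -> exists s,
  [/\ good s, size s <= n & #|missed s| * B ^ n <= #|R| * B.-1 ^ n].
Proof.
elim: n => [|n IHn] n_le; first by exists [::]; split=> //; rewrite !muln1 max_card.
have [s [good_s sz le]] := IHn (ltnW n_le).
have [missed0|missed_gt0] := posnP #|missed s|.
  by exists s; split; rewrite ?missed0 //; apply: leqW.
have [ o good_o step] := greedy_step good_s (leq_ltn_trans sz n_le) missed_gt0.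
exists (o :: s); split=> //.
rewrite !expnS mulnA; apply: leq_trans (leq_mul step (leqnn _)) _.
by rewrite -mulnA mulnCA [leqRHS]mulnCA leq_mul2l le orbT.
Qed.
End GreedyCover.

Lemma half_expn B : 0 < B -> 2 * B.-1 ^ B <= B ^ B.
Proof.
case: B => [|b] //= _.
have -> : b.+1 ^ b.+1 = (b + 1) ^ b.+1 by rewrite addn1.
rewrite expnDn.
rewrite big_ord_recl big_ord_recl addnA; apply: leq_trans (leq_addr _ _).
rewrite subn0 /= /bump /= add1n subSS subn0 bin0 bin1 !exp1n !muln1 mul1n mul2n -addnn.
by rewrite leq_add2l expnS leq_mul2r leqnSn orbT.
Qed.

(** [B] steps halve the number of missed requirements, so [B * u] steps exhaust them. *)
Lemma greedy_cover (O R : finType) (hit : R -> pred O) (good : pred (seq O))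
    (B H u : nat) : 0 < #|O| -> good [::] ->
  (forall s, good s -> size s < B * u -> 8 * #|[set o | ~~ good (o :: s)]| <= H) ->
  (forall r, H <= 4 * #|[set o | hit r o]|) ->
  0 < B -> 8 * #|O| <= B * H -> #|R| < 2 ^ u ->
  exists2 s, good s & forall r, has (hit r) s.
Proof.
move=> O_gt0 good_nil few_bad many_hit B_gt0 B_large small_R.
have [s [good_s _ le]] := greedy_iter O_gt0 good_nil few_bad many_hit B_large (leqnn _).
exists s => // r; apply: contraLR small_R => missed_r; rewrite -leqNgt.
have halves : 2 ^ u * B.-1 ^ (B * u) <= B ^ (B * u).
  by rewrite !expnM -expnMn; case: u {le few_bad} => // u; rewrite leq_exp2r // half_expn.
have : 0 < B ^ (B * u) by rewrite expn_gt0 B_gt0.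
move=> /leq_pmul2r <-.
apply: (@leq_trans (#|R| * (2 ^ u * B.-1 ^ (B * u)))); last by rewrite leq_mul2l halves orbT.
rewrite mulnCA leq_mul2l; apply/orP; right; apply: leq_trans le.
by rewrite leq_pmull // card_gt0; apply/set0Pn; exists r; rewrite inE.
Qed.

(** * Centres without three-term progressions *)

Section Conflicts.
Variables (F : finFieldType) (D : nat) (X : finType) (Z : {set F}).
Local Notation vec := {ffun 'I_D -> F}.
Hypothesis two_neq0 : (2%:R != 0 :> F)%R.

Definition nearly_AP (c1 c2 c3 : vec) : bool :=
  [forall l, (c1 l + c3 l - 2%:R * c2 l)%R \in Z].

(** Pieces are compared, not centres: if [Z] contains 0, then distinct pieces in [s] have
distinct centres. *)
Definition spread (s : seq (vec * X)) : bool :=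
  all (fun o1 => all (fun o2 => all (fun o3 =>
    nearly_AP o1.1 o2.1 o3.1 ==> (o1 == o2) && (o2 == o3)) s) s) s.

Lemma spreadP s : reflect
  (forall o1 o2 o3, o1 \in s -> o2 \in s -> o3 \in s ->
     nearly_AP o1.1 o2.1 o3.1 -> o1 = o2 /\ o2 = o3) (spread s).
Proof.
apply: (iffP allP) => [H o1 o2 o3 s1 s2 s3 nAP | H o1 s1].
  have /allP/(_ o2 s2)/allP/(_ o3 s3) := H o1 s1.
  by rewrite nAP => /andP[/eqP -> /eqP].
apply/allP => o2 s2; apply/allP => o3 s3; apply/implyP => nAP.
by have [-> ->] := H o1 o2 o3 s1 s2 s3 nAP; rewrite eqxx.
Qed.

(** A conflict between a new centre and previous ones means that an affine form of nonzero
slope, with offset determined by the previous centres, takes the new centre into [Z]. *)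
Definition affine_in (f : F * vec) (o : vec * X) : bool :=
  [forall l, (f.1 * o.1 l + f.2 l)%R \in Z].

Lemma card_affine_in f : f.1 != 0%R ->
  #|[set o | affine_in f o]| <= #|Z| ^ D * #|X|.
Proof.
move=> f_neq0; rewrite -card_vec_in -[#|X|]cardsT -cardsX.
pose h (o : vec * X) := ([ffun l => f.1 * o.1 l + f.2 l]%R : vec, o.2).
have h_inj : injective h.
  move=> [c x] [c' x'] [/ffunP Ec ->]; congr (_, _); apply/ffunP => l.
  by have := Ec l; rewrite !ffunE => /addIr /(mulfI f_neq0).
rewrite -(card_imset _ h_inj); apply: subset_leq_card.
apply/subsetP => _ /imsetP[ o near_o ->].
move: near_o; rewrite inE => /forallP near_o.
rewrite in_setX in_setT andbT inE; apply/forallP => l; rewrite ffunE.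
exact: near_o.
Qed.

Lemma card_has_affine_in (fs : seq (F * vec)) :
  all (fun f => f.1 != 0)%R fs ->
  #|[set o | has (affine_in^~ o) fs]| <= size fs * (#|Z| ^ D * #|X|).
Proof.
elim: fs => [_|f fs IHfs /= /andP[f_neq0 fs_neq0]].
  by rewrite (_ : [set o | _] = set0) ?cards0 //; apply/setP => o; rewrite !inE.
rewrite (_ : [set o | _] = [set o | affine_in f o] :|: [set o | has (affine_in^~ o) fs]).
  apply: leq_trans (leq_card_setU _ _) _.
  by rewrite mulSn leq_add ?card_affine_in // IHfs.
by apply/setP => o; rewrite !inE.
Qed.

(** The new centre occurs in [c1 + c3 - 2 c2] once at an end, in the middle, both at an end and in
the middle, or at both ends. *)
Definition conflict_forms (s : seq (vec * X)) : seq (F * vec) :=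
  [seq (1%R, [ffun l => o.1 l - 2%:R * o'.1 l]%R) | o : vec * X <- s, o' : vec * X <- s]
  ++ [seq (- 2%:R, o.1 + o'.1)%R | o : vec * X <- s, o' : vec * X <- s]
  ++ [seq (- 1, o.1)%R | o : vec * X <- s]
  ++ [seq (2%:R, [ffun l => - (2%:R * o.1 l)])%R | o : vec * X <- s].

Lemma few_conflicts s : spread s ->
  #|[set o | ~~ spread (o :: s)]| <= 2 * (size s).+1 ^ 2 * (#|Z| ^ D * #|X|).
Proof.
move=> /spreadP spread_s.
apply: (@leq_trans #|[set o | has (affine_in^~ o) (conflict_forms s)]|); last first.
  apply: leq_trans (card_has_affine_in _) _.
    apply/allP => f; rewrite !mem_cat => /or4P[/allpairsP[p [_ _ ->]]|/allpairsP[p [_ _ ->]]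
      |/mapP[p _ ->]|/mapP[p _ ->]] /=; by rewrite ?oppr_eq0 ?oner_neq0.
  rewrite leq_mul2r !size_cat !size_allpairs !size_map; apply/orP; right.
  by move: (size s) => n; clear; nia.
apply: subset_leq_card; apply/subsetP => o; rewrite !inE; apply: contraNT.
rewrite !has_cat !negb_or => /and4P[/hasPn H1 /hasPn H2 /hasPn H3 /hasPn H4].
have memE (x y : F) : x = y -> x \in Z -> y \in Z by move=> ->.
have E1 a b : a \in s -> b \in s -> nearly_AP o.1 a.1 b.1 -> False.
  move=> sa sb /forallP nAP; have /negP[] := H1 _ (allpairs_f _ sb sa).
  apply/forallP => l /=; move: (nAP l); apply: memE.
  by rewrite ?ffunE; ring.
have E2 a b : a \in s -> b \in s -> nearly_AP a.1 b.1 o.1 -> False.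
  move=> sa sb /forallP nAP; apply: (E1 b a) => //; apply/forallP => l.
  by have := nAP l; rewrite (addrC (a.1 l)).
have E3 a b : a \in s -> b \in s -> nearly_AP a.1 o.1 b.1 -> False.
  move=> sa sb /forallP nAP; have /negP[] := H2 _ (allpairs_f _ sa sb).
  apply/forallP => l /=; move: (nAP l); apply: memE.
  by rewrite ?ffunE; ring.
have E4 a : a \in s -> nearly_AP o.1 o.1 a.1 -> False.
  move=> sa /forallP nAP; have /negP[] := H3 _ (map_f _ sa).
  apply/forallP => l /=; move: (nAP l); apply: memE.
  by rewrite ?ffunE; ring.
have E5 a : a \in s -> nearly_AP a.1 o.1 o.1 -> False.
  move=> sa /forallP nAP; apply: (E4 a) => //; apply/forallP => l.
  by have := nAP l; rewrite (addrC (a.1 l)).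
have E6 a : a \in s -> nearly_AP o.1 a.1 o.1 -> False.
  move=> sa /forallP nAP; have /negP[] := H4 _ (map_f _ sa).
  apply/forallP => l /=; move: (nAP l); apply: memE.
  by rewrite ?ffunE; ring.
apply/spreadP => o1 o2 o3; rewrite !inE.
move=> /predU1P[->|s1] /predU1P[->|s2] /predU1P[->|s3] //.
- by move=> /(E4 _ s3).
- by move=> /(E6 _ s2).
- by move=> /(E1 _ _ s2 s3).
- by move=> /(E5 _ s1).
- by move=> /(E3 _ _ s1 s3).
- by move=> /(E2 _ _ s1 s2).
- exact: spread_s.
Qed.
End Conflicts.

(** * The colouring and its freeness from blue progressions *)

Section PrimeFields.
Variables (p : nat) (p_prime : prime p).

Definition initial (r : nat) : {set 'F_p} := [set x : 'F_p | (x < r)%N].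

Lemma card_initial r : r <= p -> #|initial r| = r.
Proof.
move=> le_rp; rewrite -sum1dep_card.
have le_r : r <= (Zp_trunc (pdiv p)).+2 by rewrite -[_.+2]/(pdiv p).-2.+2 Fp_cast.
by rewrite -(big_ord_widen _ (fun=> 1) le_r) sum1_card card_ord.
Qed.

Definition near (r : nat) : {set 'F_p} :=
  [set (j%:R)%R | j : 'I_r] :|: [set (- j%:R)%R | j : 'I_r].

Lemma card_near r : #|near r| <= 2 * r.
Proof.
apply: leq_trans (leq_card_setU _ _) _; rewrite mul2n -addnn.
by rewrite leq_add // (leq_trans (leq_imset_card _ _)) // cardT size_enum_ord.
Qed.

Lemma near_sub r a b : (a < r)%N -> (b < r)%N -> (a%:R - b%:R)%R \in near r.
Proof.
move=> ar br; rewrite inE; apply/orP; have [le_ba|lt_ab] := leqP b a; [left|right].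
  apply/imsetP; exists (Ordinal (leq_ltn_trans (leq_subr b a) ar)) => //=.
  by rewrite natrB.
apply/imsetP; exists (Ordinal (leq_ltn_trans (leq_subr a b) br)) => //=.
by rewrite natrB 1?ltnW // opprB.
Qed.

Lemma natr_Fp_inj a b : a < p -> b < p -> (a%:R = b%:R :> 'F_p)%R -> a = b.
Proof.
move=> ap bp /(congr1 (fun x : 'F_p => nat_of_ord x)).
by rewrite !val_Fp_nat // !modn_small.
Qed.
End PrimeFields.

(** The parallelogram law in one coordinate; subtraction being truncated,
[(a - b) + (b - a)] is the distance of [a] and [b]. *)
Lemma second_difference a b c : a + c = 2 * b ->
  a ^ 2 + c ^ 2 = 2 * b ^ 2 + 2 * ((a - b) + (b - a)) ^ 2.
Proof.
move=> E; have [le|/ltnW le] := leqP a b.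
  have -> : c = b + (b - a) by lia.
  have -> : a - b = 0 by lia.
  have {1}-> : a = b - (b - a) by lia.
  have : b - a <= b by lia.
  move: (b - a) => v; clear; nia.
have -> : c = b - (a - b) by lia.
have -> : b - a = 0 by lia.
have {1}-> : a = b + (a - b) by lia.
have : a - b <= b by lia.
by move: (a - b) => v; clear; nia.
Qed.

Section Coloring.
Variables (p p' : nat) (p_prime : prime p) (p'_prime : prime p').
Variables (D L m G Delta : nat).
Local Notation vec := {ffun 'I_D -> 'F_p}.
Local Notation label := ('F_p' * 'F_p')%type.

Definition shell (c : vec) (x : vec) : 'F_p' :=
  ((G * \sum_l (x l - c l)%R ^ 2)%N%:R)%R.

Definition in_piece (theta : vec) (o : vec * label) (n : nat) : bool :=
  [forall l, (theta l * n%:R - o.1 l)%R \in initial p L] &&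
  ((n%:R * o.2.1 + o.2.2 + shell o.1 [ffun l => theta l * n%:R])%R \in initial p' Delta).

Hypothesis L_small : 2 * L <= p.
Hypothesis no_wrap : 2 * Delta + 2 * G * D * L ^ 2 <= p'.
Hypothesis Delta_le : Delta <= G * m ^ 2.

(** The paraboloid is strictly convex, its linear part cancels on progressions, and the bound
on [p'] turns congruences between window values into equalities. *)
Lemma no_3AP_in_pieces (theta : vec) (s : seq (vec * label)) (n d : nat) :
  spread (near p (2 * L)) s -> [exists l, (d%:R * theta l)%R \notin near p m] ->
  has (in_piece theta ^~ n) s -> has (in_piece theta ^~ (n + d)) s ->
  has (in_piece theta ^~ (n + 2 * d)) s -> False.
Proof.
move=> /spreadP spread_s /existsP[l0 far_l0].
move=> /hasP[ o1 s1 /andP[/forallP box1 win1]] /hasP[ o2 s2 /andP[/forallP box2 win2]].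
move=> /hasP[ o3 s3 /andP[/forallP box3 win3]].
have lt_L (x : 'F_p) : x \in initial p L -> (x < L)%N by rewrite inE.
(* If the three points lie in cells, their centres are nearly in progression, hence
   they belong to the same piece. *)
have [|E12 E23] := spread_s _ _ _ s1 s2 s3.
  apply/forallP => l.
  move: (lt_L _ (box1 l)) (lt_L _ (box2 l)) (lt_L _ (box3 l)).
  set u1 := (_ - o1.1 l)%R; set u2 := (_ - o2.1 l)%R; set u3 := (_ - o3.1 l)%R => lt1 lt2 lt3.
  have -> : (o1.1 l + o3.1 l - 2%:R * o2.1 l = (2 * u2)%N%:R - (u1 + u3)%N%:R)%R.
    rewrite natrM natrD !natr_Zp /u1 /u2 /u3.
    rewrite (natrD _ n d) (natrD _ n (2 * d)) (natrM _ 2 d); ring.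
  by apply: near_sub; move: lt1 lt2 lt3; clear; lia.
subst o2 o3; set c := o1.1 in box1 box2 box3 win1 win2 win3.
pose e n' l : nat := (theta l * n'%:R - c l)%R.
have e_lt1 l : e n l < L := lt_L _ (box1 l).
have e_lt2 l : e (n + d) l < L := lt_L _ (box2 l).
have e_lt3 l : e (n + 2 * d) l < L := lt_L _ (box3 l).
have eR n' l : ((e n' l)%:R = theta l * n'%:R - c l)%R by rewrite natr_Zp.
have e_AP l : e n l + e (n + 2 * d) l = 2 * e (n + d) l.
  apply: (natr_Fp_inj p_prime).
  - by move: (e_lt1 l) (e_lt3 l) L_small; clear; lia.
  - by move: (e_lt2 l) L_small; clear; lia.
  by rewrite natrD natrM !eR (natrD _ n d) (natrD _ n (2 * d)) (natrM _ 2 d); ring.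
pose v l := (e n l - e (n + d) l) + (e (n + d) l - e n l).
have v_lt l : v l < L by move: (e_lt1 l) (e_lt2 l); rewrite /v; clear; lia.
have v_far : m <= v l0.
  rewrite leqNgt; apply: contra far_l0 => lt_m.
  have -> : (d%:R * theta l0 = (e (n + d) l0 - e n l0)%N%:R - (e n l0 - e (n + d) l0)%N%:R)%R.
    have -> : (d%:R * theta l0 = (e (n + d) l0)%:R - (e n l0)%:R)%R.
      by rewrite !eR natrD; ring.
    have [le|/ltnW le] := leqP (e n l0) (e (n + d) l0).
      by rewrite (eqP le) natrB // subr0.
    by rewrite (eqP le) natrB // sub0r opprB.
  by apply: near_sub; move: lt_m; rewrite /v; clear; lia.
pose V := \sum_l v l ^ 2.
have V_ge : m ^ 2 <= V.
  by apply: (@leq_trans (v l0 ^ 2)); rewrite ?leq_exp2r // /V (bigD1 l0) //= leq_addr.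
have V_le : V <= D * L ^ 2.
  rewrite -[D in D * _]card_ord -sum_nat_const; apply: leq_sum => l _.
  by rewrite leq_exp2r // ltnW.
have shellE n' : shell c [ffun l => theta l * n'%:R]%R = ((G * \sum_l e n' l ^ 2)%N%:R)%R.
  by rewrite /shell; congr ((_ * _)%N%:R)%R; apply: eq_bigr => l _; rewrite ffunE.
have sumE : \sum_l e n l ^ 2 + \sum_l e (n + 2 * d) l ^ 2 =
    2 * \sum_l e (n + d) l ^ 2 + 2 * V.
  rewrite /V !big_distrr -!big_split; apply: eq_bigr => l _ /=.
  exact: second_difference.
pose X n' := G * \sum_l e n' l ^ 2.
have XE : X n + X (n + 2 * d) = 2 * X (n + d) + 2 * G * V.
  by rewrite /X -mulnDr sumE; ring.
have XR : ((X n)%:R + (X (n + 2 * d))%:R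
    = 2%:R * (X (n + d))%:R + (2 * G * V)%:R :> 'F_p')%R.
  by rewrite -natrM -!natrD XE.
move: win1 win2 win3; rewrite !shellE.
set h1 := (_ + _)%R; set h2 := (_ + _)%R; set h3 := (_ + _)%R; rewrite !inE => lt1 lt2 lt3.
have Eh : ((h1 + h3)%N%:R = (2 * h2 + 2 * G * V)%N%:R :> 'F_p')%R.
  rewrite (natrD _ h1 h3) (natrD _ (2 * h2) (2 * G * V)) (natrM _ 2 h2) !natr_Zp.
  have -> : ((2 * G * V)%:R = (X n)%:R + (X (n + 2 * d))%:R - 2%:R * (X (n + d))%:R :> 'F_p')%R.
    by rewrite XR addrC addKr.
  rewrite /h1 /h2 /h3 -/(X n) -/(X (n + d)) -/(X (n + 2 * d)).
  rewrite (natrD _ n d) (natrD _ n (2 * d)) (natrM _ 2 d); ring.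
have GV : 2 * G * V <= 2 * G * D * L ^ 2 by rewrite -!mulnA !leq_mul2l V_le !orbT.
have EhN : h1 + h3 = 2 * h2 + 2 * G * V.
  apply: (natr_Fp_inj p'_prime) Eh; first by lia.
  by apply: leq_trans no_wrap; lia.
have : G * m ^ 2 <= G * V by rewrite leq_mul2l V_ge orbT.
by move: EhN; rewrite -mulnA; lia.
Qed.
End Coloring.

(** * The construction, and its parameters *)

Section Construction.
Variables (p p' : nat) (p_prime : prime p) (p'_prime : prime p').
Variables (D s K T E Q B u N k m L G : nat).
Local Notation Delta := (G * m ^ 2).
Local Notation H := (k * L ^ D * (p' * Delta)).
Hypotheses (p_gt2 : 2 < p) (N_lt_p : N < p) (k_le_p : k <= p).
Hypotheses (N_lt_p' : N < p') (k_le_p' : k <= p').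
Hypotheses (L_small : 2 * (2 * L) <= p) (window_small : 2 * L * K <= p).
Hypotheses (rare : E * p <= L * T) (k_le : k <= T * K ^ s).
Hypotheses (few_near : 2 * N * (2 * m) ^ D < p ^ D).
Hypotheses (few_clumped : 2 * N * Q * 2 ^ D < E ^ (D - s)).
Hypotheses (Q_large : 2 * p ^ D <= Q * L ^ D).
Hypotheses (shell_thin : T * Delta <= p').
Hypotheses (no_wrap : 2 * Delta + 2 * G * D * L ^ 2 <= p').
Hypotheses (few_bad : 8 * (2 * (B * u) ^ 2 * ((2 * (2 * L)) ^ D * p' ^ 2)) <= H).
Hypotheses (B_gt0 : 0 < B) (B_large : 8 * (p ^ D * p' ^ 2) <= B * H).
Hypothesis few_APs : N.+1 * N < 2 ^ u.

(** [few_near] and [few_clumped] provide the frequencies; [few_bad] and [B_large] compare the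
numbers of conflicting pieces and of all pieces with the lower bound [H / 4] for the
number of pieces that hit a given progression. *)
Lemma coloring_exists : exists blue : pred nat,
  (forall n d, 0 < d <= N -> blue n -> blue (n + d) -> ~~ blue (n + 2 * d)) /\
  (forall a d, a <= N -> 0 < d <= N -> exists2 i, i < k & blue (a + i * d)).
Proof.
have natr_neq0 (q j : nat) : prime q -> 0 < j -> j < q -> (j%:R != 0 :> 'F_q)%R.
  move=> q_prime j_gt0 jq; apply: contraTneq j_gt0 => j0.
  by rewrite (natr_Fp_inj q_prime jq (prime_gt0 q_prime) j0).
have alpha_inj : injective (fun i : 'I_k => (i%:R : 'F_p)%R).
  move=> i j /(natr_Fp_inj p_prime) Eij; apply/val_inj/Eij;
    exact: leq_trans (ltn_ord _) k_le_p.
have L_le_p : L <= p by move: L_small; clear; lia.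
have Delta_le_p' : Delta <= p'.
  by apply: leq_trans no_wrap; rewrite mul2n -addnn -addnA leq_addr.
pose delta (d : 'I_N) : 'F_p := (d.+1%:R)%R.
have delta_neq0 d : delta d != 0%R.
  by apply: natr_neq0 => //; apply: leq_ltn_trans N_lt_p.
have [theta Htheta] : exists theta : {ffun 'I_D -> 'F_p}, forall d : 'I_N,
    [exists l, (delta d * theta l)%R \notin near p m] /\
    #|[set z | T < #|visits (initial p L) (fun i : 'I_k => (i%:R)%R)
         [ffun l => delta d * theta l]%R z|]| * Q <= #|'F_p| ^ D.
  apply: (exists_generic_frequencies alpha_inj (K := K) (E := E) (s := s)) => //;
    rewrite ?card_initial ?card_Fp ?card_ord //.
  apply: leq_ltn_trans few_near; rewrite leq_mul2l; apply/orP; right.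
  by case: (D) => // D'; rewrite leq_exp2r // card_near.
pose O := ({ffun 'I_D -> 'F_p} * ('F_p' * 'F_p'))%type.
pose hit (r : 'I_N.+1 * 'I_N) (o : O) :=
  [exists i : 'I_k, in_piece L G Delta theta o (r.1 + i * r.2.+1)].
have card_O : #|{: O}| = p ^ D * p' ^ 2.
  by rewrite !card_prod card_ffun !card_Fp // card_ord mulnn.
have many_hit r : H <= 4 * #|[set o | hit r o]|.
  case: r => a d; rewrite /hit /=.
  pose y := [ffun l => delta d * theta l]%R.
  pose x := [ffun l => theta l * a%:R]%R.
  pose gamma (i : 'I_k) : 'F_p' := ((a + i * d.+1)%N%:R)%R.
  pose beta (c : {ffun 'I_D -> 'F_p}) (i : 'I_k) :=
    shell p' G c [ffun l => theta l * (a + i * d.+1)%N%:R]%R.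
  have gamma_inj : injective gamma.
    move=> i j; rewrite /gamma (natrD _ a (i * _)) (natrD _ a (j * _)) => /addrI.
    rewrite (natrM _ i) (natrM _ j).
    move=> /(mulIf (natr_neq0 _ _ p'_prime (ltn0Sn d) (leq_ltn_trans (ltn_ord d) N_lt_p'))).
    by move=> /(natr_Fp_inj p'_prime) Eij; apply/val_inj/Eij;
      exact: leq_trans (ltn_ord _) k_le_p'.
  have [_ seldom] := Htheta d.
  have := many_hits (W := initial p' Delta) x beta gamma_inj seldom.
  rewrite !card_initial // !card_Fp // card_ord => /(_ Q_large shell_thin).
  move=> /leq_trans; apply; rewrite leq_mul2l /=; apply: subset_leq_card.
  apply/subsetP => o; rewrite !inE => /existsP[i /andP[]]; rewrite inE => /forallP box win.
  apply/existsP; exists i; apply/andP; split=> //; apply/forallP => l.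
  have := box l; rewrite !ffunE.
  rewrite (natrD _ a) (natrM _ i) /delta; set z := (_ + _)%R; set z' := (_ - _)%R.
  by have -> : z = z' by rewrite /z /z'; ring.
have two_neq0 : (2%:R != 0 :> 'F_p)%R by exact: natr_neq0.
have [|||||||ss spread_ss all_hit] := greedy_cover (hit := hit)
  (good := spread (near p (2 * L))) (B := B) (H := H) (u := u) => //.
- by rewrite card_O muln_gt0 !expn_gt0 !prime_gt0.
- move=> t spread_t lt_t; apply: leq_trans few_bad; rewrite leq_mul2l /=.
  apply: leq_trans (few_conflicts two_neq0 spread_t) _.
  rewrite card_prod !card_Fp // -mulnn leq_mul //.
    by rewrite leq_mul2l /= -[leqRHS]mulnn leq_mul.
  rewrite mulnn leq_mul2r; apply/orP; right.
  by case: (D) => // D'; rewrite leq_exp2r // card_near.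
- by rewrite card_O.
- by rewrite card_prod !card_ord.
exists (fun n => has (in_piece L G Delta theta ^~ n) ss); split.
  move=> n d /andP[d_gt0 d_le] b1 b2; apply/negP => b3.
  have d_ord : d.-1 < N by rewrite prednK.
  have [far _] := Htheta (Ordinal d_ord); rewrite /delta /= prednK // in far.
  have L2_le : 2 * L <= p by move: L_small; clear; lia.
  exact: (no_3AP_in_pieces p_prime p'_prime L2_le no_wrap (leqnn _) spread_ss far b1 b2 b3).
move=> a d a_le /andP[d_gt0 d_le].
have d_ord : d.-1 < N by rewrite prednK.
have a_ord : a < N.+1 by rewrite ltnS.
have /hasP[ o o_ss /existsP[i]] := all_hit (Ordinal a_ord, Ordinal d_ord).
rewrite /= prednK // => blue_o; exists i => //.
by apply/hasP; exists o.
Qed.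
End Construction.

Lemma affine_le_expn t : 6 * t + 1 <= 2 ^ (3 * t).
Proof.
elim: t => // t IHt; rewrite (mulnS 3) expnD.
by move: IHt; move: (2 ^ (3 * t)) => x; rewrite (_ : 2 ^ 3 = 8) //; clear; lia.
Qed.

Lemma sqr_lt_expn t : t ^ 2 < 2 ^ (2 * t).
Proof. by rewrite mulnC expnM ltn_exp2r // ltn_expl. Qed.

Section Scales.
Variables (r t : nat).
Hypotheses (r_eq : r = 20) (t_ge3 : 3 <= t).

(** In the proof, [m / L = 2 ^ - e] and [L / p] is about [2 ^ - r]. The density of the window is
about [m ^ 2 / (4 D L ^ 2) = 1 / (4 D T)], and a piece is hit with probability about
[k (L / p) ^ D / (4 D T)]. With [k = T K ^ (5 t)] and [K = 2 ^ (r - 1)] this exceeds the cube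
root of the cell volume [2 ^ (- r D)] by a factor exponential in [t] once [r = 20]; [r] stays a
variable only so that its powers are never evaluated. *)
Lemma coloring_of_parameters : exists blue : pred nat,
  (forall n d, 0 < d <= 2 ^ (t ^ 2) -> blue n -> blue (n + d) -> ~~ blue (n + 2 * d)) /\
  (forall a d, a <= 2 ^ (t ^ 2) -> 0 < d <= 2 ^ (t ^ 2) ->
     exists2 i, i < 2 ^ (255 * t) & blue (a + i * d)).
Proof.
have [N N_eq] : {N | N = 2 ^ (t ^ 2)} by exists (2 ^ (t ^ 2)).
have [k k_eq] : {k | k = 2 ^ (255 * t)} by exists (2 ^ (255 * t)).
have [D D_eq] : {D | D = 6 * t} by exists (6 * t).
have [T T_eq] : {T | T = 2 ^ (160 * t)} by exists (2 ^ (160 * t)).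
have [e e_eq] : {e | e = 80 * t} by exists (80 * t).
have D_gt0 : 0 < D by rewrite D_eq; move: t_ge3; clear; lia.
(* Any large primes [p] and [p'] will do: [m] and [G] adapt to them, and only
   ratios such as [L / p] and [Delta / p'] matter. *)
have [p p_big p_prime] := prime_above (N + k + 2 ^ (r + e) + 2).
pose m := p %/ 2 ^ (r + e).
have [L L_eq] : {L | L = 2 ^ e * m} by exists (2 ^ e * m).
have m_gt0 : 0 < m by rewrite divn_gt0 ?expn_gt0 //; move: p_big; clear; lia.
have L_gt0 : 0 < L by rewrite L_eq muln_gt0 expn_gt0.
have m_le_L : m <= L by rewrite L_eq leq_pmull ?expn_gt0.
have le_p : L * 2 ^ r <= p.
  by rewrite L_eq mulnC mulnA -expnD mulnC leq_divM.
have p_le : p <= L * 2 ^ r.+1.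
  have : p < m.+1 * 2 ^ (r + e) by rewrite ltn_ceil ?expn_gt0.
  rewrite L_eq expnS expnD; move: m_gt0; move: (2 ^ r) (2 ^ e) (m) => x y z; clear; nia.
have m_le_p : (2 * m) * 2 ^ (r.-1 + e) <= p.
  rewrite -mulnA mulnCA -expnS -addSn prednK ?r_eq // -r_eq.
  exact: leq_divM.
move: (m) L_eq m_gt0 m_le_L m_le_p => {}m L_eq m_gt0 m_le_L m_le_p.
have TE : T * m ^ 2 = L ^ 2.
  by rewrite T_eq L_eq e_eq expnMn -expnM mulnAC.
have [V V_eq] : {V | V = 2 * D.+1 * L ^ 2} by exists (2 * D.+1 * L ^ 2).
have V_gt0 : 0 < V by rewrite V_eq muln_gt0 expn_gt0 L_gt0.
have [p' p'_big p'_prime] := prime_above (N + k + V).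
have [G [G_gt0 le_p' p'_le]] : exists G, [/\ 0 < G, G * V <= p' & p' <= 2 * (G * V)].
  have G_gt0 : 0 < p' %/ V by rewrite divn_gt0 //; move: p'_big; clear; lia.
  exists (p' %/ V); split=> //; first exact: leq_divM.
  have : p' < (p' %/ V).+1 * V by rewrite ltn_ceil.
  by move: G_gt0; move: (p' %/ V) => x; clear; nia.
have p'_le_T : p' <= 4 * D.+1 * T * (G * m ^ 2).
  apply: leq_trans p'_le _; rewrite V_eq -TE; move: (m ^ 2) => M.
  by rewrite (_ : 2 * _ = 4 * D.+1 * T * (G * M)) //; ring.
have pD_le : p ^ D <= 2 ^ (126 * t) * L ^ D.
  rewrite (_ : 126 * t = r.+1 * D); last by rewrite r_eq D_eq; clear; lia.
  by rewrite expnM -expnMn leq_exp2r // mulnC.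
have D_le : 4 * D.+1 <= 2 ^ (3 * t + 2).
  by rewrite expnD mulnC leq_mul // D_eq -addn1 affine_le_expn.
rewrite -N_eq -k_eq.
apply: (@coloring_exists p p' p_prime p'_prime D (5 * t) (2 ^ r.-1) T
  (2 ^ (160 * t - 21)) (2 ^ (126 * t + 1)) (2 ^ (34 * t + 5)) (2 ^ (2 * t + 1))
  N k m L G).
- by move: p_big; clear; lia.
- by move: p_big; clear; lia.
- by move: p_big; clear; lia.
- by move: p'_big; clear; lia.
- by move: p'_big; clear; lia.
- apply: leq_trans le_p; rewrite mulnA mulnC leq_mul2l; apply/orP; right.
  by rewrite (_ : 2 * 2 = 2 ^ 2) // leq_exp2l // r_eq.
- by rewrite -mulnA mulnCA -expnS prednK ?r_eq // -r_eq.
- apply: leq_trans (leq_mul (leqnn _) p_le) _.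
  rewrite mulnCA leq_mul2l T_eq; apply/orP; right.
  by rewrite -expnD leq_exp2l // r_eq; move: t_ge3; clear; lia.
- by rewrite k_eq T_eq -expnM -expnD leq_exp2l // r_eq; clear; lia.
- move: m_le_p; rewrite -(leq_exp2r _ _ D_gt0) expnMn -expnM; apply: leq_trans.
  rewrite mulnC ltn_pmul2l ?expn_gt0 ?muln_gt0 ?m_gt0 //.
  rewrite N_eq -expnS ltn_exp2l // r_eq D_eq e_eq -mulnn.
  by move: t_ge3; clear; nia.
- rewrite N_eq D_eq -expnS -!expnD -expnM ltn_exp2l // -mulnn.
  by move: t_ge3; clear; nia.
- by rewrite addn1 expnS -mulnA leq_mul2l pD_le orbT.
- by rewrite mulnCA TE; apply: leq_trans le_p'; rewrite leq_mul2l V_eq leq_pmull ?orbT.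
- apply: leq_trans le_p'; rewrite V_eq.
  have : m ^ 2 <= L ^ 2 by rewrite leq_exp2r.
  by move: (m ^ 2) (L ^ 2) => a b; clear; nia.
- rewrite -expnD -expnM.
  have -> : (2 * (2 * L)) ^ D = 2 ^ (12 * t) * L ^ D.
    by rewrite mulnA expnMn (_ : 2 * 2 = 2 ^ 2) // -expnM D_eq mulnA.
  rewrite (_ : 8 * _ = 2 ^ 4 * 2 ^ ((34 * t + 5 + (2 * t + 1)) * 2) * 2 ^ (12 * t) * p' * (L ^ D * p')); last first.
    by rewrite (_ : 2 ^ 4 = 16) //; ring.
  rewrite (_ : k * _ * _ = k * (G * m ^ 2) * (L ^ D * p')); last by ring.
  rewrite leq_mul2r; apply/orP; right; rewrite -!expnD.
  apply: leq_trans (leq_mul (leqnn _) p'_le_T) _.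
  rewrite mulnA leq_mul2r; apply/orP; right.
  apply: leq_trans (leq_mul (leqnn _) (leq_mul D_le (leqnn _))) _.
  rewrite T_eq k_eq -!expnD leq_exp2l //; move: t_ge3; clear; lia.
- by rewrite expn_gt0.
- apply: (@leq_trans (8 * 2 ^ (126 * t) * p' * (L ^ D * p'))).
    rewrite (_ : 8 * (p ^ D * p' ^ 2) = p ^ D * (8 * p' * p')); last by ring.
    rewrite (_ : 8 * _ * _ * _ = 2 ^ (126 * t) * L ^ D * (8 * p' * p')); last by ring.
    by rewrite leq_mul2r pD_le orbT.
  rewrite (_ : _ * (k * _ * _) = 2 ^ (34 * t + 5) * k * (G * m ^ 2) * (L ^ D * p')); last by ring.
  rewrite leq_mul2r; apply/orP; right.
  apply: leq_trans (leq_mul (leqnn _) p'_le_T) _.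
  rewrite mulnA leq_mul2r; apply/orP; right.
  apply: leq_trans (leq_mul (leqnn _) (leq_mul D_le (leqnn _))) _.
  rewrite (_ : 8 = 2 ^ 3) // T_eq k_eq -!expnD leq_exp2l //; move: t_ge3; clear; lia.
- have N_gt0 : 0 < N by rewrite N_eq expn_gt0.
  apply: (@leq_ltn_trans (2 * N * N)); first by rewrite leq_mul2r mul2n -addnn -addn1 leq_add2l N_gt0 orbT.
  rewrite N_eq -expnS -expnD ltn_exp2l // expnD (_ : 2 ^ 1 = 2) //.
  by have := sqr_lt_expn t; move: (t ^ 2) (2 ^ _) => x y; clear; lia.
Qed.
End Scales.

(** * Lower bounds for van der Waerden numbers *)

Lemma vdW_lower_bound t k : 3 <= t -> 2 ^ (255 * t) <= k -> 2 ^ (t ^ 2) < w 3 k.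
Proof.
move=> t_ge3 le_k; rewrite ltnNge; apply/negP.
have [blue [no_3AP meets]] := coloring_of_parameters erefl t_ge3.
rewrite /w; case: ex_minnP => n /andP[_ /asboolP forces] _.
move: (2 ^ (t ^ 2)) no_3AP meets => N no_3AP meets le_nN.
pose c n := if blue n then Blue else Red.
have cB x : c x = Blue -> blue x by rewrite /c; case: ifP.
have cR x : c x = Red -> ~~ blue x by rewrite /c; case: ifP.
have k_gt1 : 1 < 2 ^ (255 * t).
  by rewrite -[1](expn0 2) ltn_exp2l //; move: t_ge3; clear; lia.
have [[a [d [d_gt0 AP]]]|[a [d [d_gt0 AP]]]] := forces c.
  have [_ b0] := AP 0 isT; have [_ b1] := AP 1 isT; have [/andP[_ le2] b2] := AP 2 isT.
  have dN : 0 < d <= N by rewrite d_gt0; move: le2 le_nN; clear; lia.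
  move: b0 b1 b2; rewrite mul0n addn0 mul1n => /cB b0 /cB b1 /cB b2.
  by have := no_3AP a d dN b0 b1; rewrite b2.
have [/andP[_ le0] _] := AP 0 (leq_trans (ltnW k_gt1) le_k).
have [/andP[_ le1] _] := AP 1 (leq_trans k_gt1 le_k).
have aN : a <= N by move: le0 le_nN; clear; lia.
have dN : 0 < d <= N by rewrite d_gt0; move: le1 le_nN; clear; lia.
have [i lt_i blue_i] := meets a d aN dN.
have [_ /cR] := AP i (leq_trans lt_i le_k).
by rewrite blue_i.
Qed.

(** The exponents [255 t] and [510 t] are comparable, so [t] is of order [log k]. *)
Lemma dyadic_scale k : 2 ^ (255 * 3) <= k ->
  exists t, [/\ 3 <= t, 2 ^ (255 * t) <= k & k <= 2 ^ (510 * t)].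
Proof.
move=> k_big; have k_gt0 : 0 < k by apply: leq_trans k_big; rewrite expn_gt0.
have j_ge : 255 * 3 <= trunc_log 2 k by apply: trunc_log_max.
have /andP[lo hi] := @trunc_log_bounds 2 k isT k_gt0.
move: (trunc_log 2 k) j_ge lo hi => j j_ge lo hi.
exists (j %/ 255); split.
- by move: j_ge; clear; lia.
- by apply: leq_trans lo; rewrite leq_exp2l // mulnC leq_divM.
apply: leq_trans (ltnW hi) _; rewrite leq_exp2l //; move: j_ge; clear; lia.
Qed.

Local Open Scope ring_scope.

Theorem theorem1p1 (R : realType) :
  exists c : R, 0 < c /\
    exists K : nat, forall k : nat, (K <= k)%N ->
      (k%:R : R) `^ (c * ln (k%:R : R)) <= (w 3 k)%:R.
Proof.
have c_gt0 : (0 : R) < 510 by rewrite ltr0n.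
exists ((510 ^+ 2)^-1); split; first by rewrite invr_gt0 exprn_gt0.
exists (2 ^ (255 * 3))%N => k /dyadic_scale[t [t_ge3 le_k k_le]].
apply: (@le_trans _ _ (2 ^ (t ^ 2))%N%:R); last first.
  by rewrite ler_nat ltnW // vdW_lower_bound.
have k_gt0 : (0 : R) < k%:R.
  by rewrite ltr0n; apply: leq_trans le_k; rewrite expn_gt0.
have ln_k_ge0 : 0 <= ln (k%:R : R) by rewrite ln_ge0 // ler1n -(ltr_nat R).
have ln2_ge0 : 0 <= ln (2 : R) by rewrite ln_ge0 // ler1n.
have ln2_le1 : ln (2 : R) <= 1 by rewrite (_ : 2 = 1 + 1) // le_ln1Dx // ltrN10.
have ln_k_le : ln (k%:R : R) <= 510 * t%:R * ln 2.
  rewrite -natrM mulrC mulr_natr -lnXn ?ltr0n //.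
  by rewrite ler_ln ?posrE ?exprn_gt0 // -natrX ler_nat.
rewrite natrX -[leRHS]lnK ?posrE ?exprn_gt0 // /powR gt_eqF // ler_expR lnXn //.
rewrite -[leRHS]mulr_natr natrX -mulrA ler_pdivrMl ?exprn_gt0 //.
apply: (@le_trans _ _ ((510 * t%:R * ln 2) ^+ 2)).
  rewrite -expr2; apply: lerXn2r (ln_k_le); rewrite nnegrE.
    exact: ln_k_ge0.
  exact: le_trans ln_k_le.
rewrite exprMn exprMn -mulrA ler_pM2l ?exprn_gt0 // mulrC.
by rewrite ler_wpM2r ?sqr_ge0 // expr2 ler_piMl.
Qed.
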